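(* Let $\mathbb{K}$ be an algebraically closed field of characteristic zero, $\mathcal{C}\subset\mathbb{K}^2$ an affine irreducible plane curve defined by an irreducible polynomial $f(y_1,y_2)$, $A=(a,b)\in\mathbb{K}^2$, $d\in\mathbb{K}\setminus\{0\}$, and assume $\mathcal{C}_0\neq\emptyset$. Then: (1) all irreducible components of $\mathfrak{B}(\mathcal{C},A,d)$ have dimension $1$; (2) if $\mathcal{C}$ is not the circle centered at $A$ of radius $d$, all irreducible components of $\mathfrak{C}(\mathcal{C},A,d)$ have dimension $1$; (3) if $\mathcal{C}$ is the circle centered at $A$ of radius $d$, then $\mathfrak{C}(\mathcal{C},A,d)$ is the union of $\{A\}$ and the circle centered at $A$ of radius $2d$; (4) $\mathfrak{C}(\mathcal{C},A,d)$ has at most two irreducible components.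
   Context: The circle centered at $(c_1,c_2)$ of radius $r$ is the curve $(x_1-c_1)^2+(x_2-c_2)^2=r^2$. $\mathfrak{B}(\mathcal{C},A,d)\subset\mathbb{K}^2\times\mathbb{K}^2\times\mathbb{K}$ is the algebraic set of $(\bar x,\bar y,w)$ with $f(y_1,y_2)=0$, $(x_1-y_1)^2+(x_2-y_2)^2=d^2$, $(y_2-b)(x_1-y_1)-(y_1-a)(x_2-y_2)=0$, $w((y_1-a)^2+(y_2-b)^2)=1$. With $\pi_1(\bar x,\bar y,w)=\bar x$, the conchoid $\mathfrak{C}(\mathcal{C},A,d)$ is the Zariski closure in $\mathbb{K}^2$ of $\pi_1(\mathfrak{B}(\mathcal{C},A,d))$. $\mathcal{C}_0=\{(p_1,p_2)\in\mathcal{C}:(p_1-a)^2+(p_2-b)^2\neq0\}$. *)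

(* Defs.v *)
From HB Require Import structures.
From mathcomp Require Import all_boot all_order all_algebra.
From mathcomp Require Import mpoly.
Set Implicit Arguments. Unset Strict Implicit. Unset Printing Implicit Defensive.
Import Order.TTheory GRing.Theory Num.Theory.
Local Open Scope ring_scope.

Section Zariski.
Variable K : fieldType.

Definition pt (n : nat) := 'rV[K]_n.
Definition pset (n : nat) := pt n -> Prop.

Definition psubset n (A B : pset n) := forall x, A x -> B x.
Definition pseteq n (A B : pset n) := forall x, A x <-> B x.

Definition peval n (p : {mpoly K[n]}) (x : pt n) : K := p.@[fun i => x ord0 i].

Definition zero_set n (S : {mpoly K[n]} -> Prop) : pset n :=
  fun x => forall p, S p -> peval p x = 0.
Definition zclosed n (Z : pset n) := exists S, pseteq Z (zero_set S).

Definition zclosure n (A : pset n) : pset n :=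
  fun x => forall Z, zclosed Z -> psubset A Z -> Z x.

Definition zirreducible n (Y : pset n) :=
  (exists x, Y x) /\
  forall Z1 Z2 : pset n, zclosed Z1 -> zclosed Z2 ->
    psubset Y (fun x => Z1 x \/ Z2 x) -> psubset Y Z1 \/ psubset Y Z2.

Definition irr_component n (X Y : pset n) :=
  [/\ psubset Y X, zirreducible Y &
      forall Y' : pset n, psubset Y Y' -> psubset Y' X -> zirreducible Y' ->
        psubset Y' Y].

Definition has_chain n (Y : pset n) (m : nat) :=
  exists Z : nat -> pset n,
    (forall i, (i <= m)%N -> [/\ zclosed (Z i), zirreducible (Z i) & psubset (Z i) Y]) /\
    (forall i, (i < m)%N -> psubset (Z i) (Z i.+1) /\ ~ psubset (Z i.+1) (Z i)).
Definition zdim_eq n (Y : pset n) (m : nat) := has_chain Y m /\ ~ has_chain Y m.+1.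

Definition irreducible_mpoly n (f : {mpoly K[n]}) :=
  [/\ f != 0, f \isn't a GRing.unit &
      forall g h : {mpoly K[n]}, f = g * h -> g \is a GRing.unit \/ h \is a GRing.unit].

Definition c2 (x : pt 2) (k : nat) : K := x ord0 (inord k).
Definition c5 (v : pt 5) (k : nat) : K := v ord0 (inord k).

Definition curve (f : {mpoly K[2]}) : pset 2 := fun y => peval f y = 0.

Definition circle (a b r : K) : pset 2 :=
  fun x => (c2 x 0 - a) ^+ 2 + (c2 x 1 - b) ^+ 2 = r ^+ 2.

Definition curve0 (f : {mpoly K[2]}) (a b : K) : pset 2 :=
  fun p => curve f p /\ (c2 p 0 - a) ^+ 2 + (c2 p 1 - b) ^+ 2 != 0.

Definition mkpt2 (u1 u2 : K) : pt 2 := \row_(i < 2) (if i == 0 :> nat then u1 else u2).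

Definition Bset (f : {mpoly K[2]}) (a b d : K) : pset 5 := fun v =>
  let x1 := c5 v 0 in let x2 := c5 v 1 in
  let y1 := c5 v 2 in let y2 := c5 v 3 in let w := c5 v 4 in
  [/\ peval f (mkpt2 y1 y2) = 0,
      (x1 - y1) ^+ 2 + (x2 - y2) ^+ 2 = d ^+ 2,
      (y2 - b) * (x1 - y1) - (y1 - a) * (x2 - y2) = 0 &
      w * ((y1 - a) ^+ 2 + (y2 - b) ^+ 2) = 1].

Definition proj1_pt (v : pt 5) : pt 2 := mkpt2 (c5 v 0) (c5 v 1).
Definition conchoid (f : {mpoly K[2]}) (a b d : K) : pset 2 :=
  zclosure (fun x => exists v, Bset f a b d v /\ x = proj1_pt v).

End Zariski.

(* Main.v *)
Require Import Defs.
From HB Require Import structures.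
From mathcomp Require Import all_boot all_order all_algebra ring zify.
From mathcomp Require Import mpoly.
From Stdlib Require Import Classical.
Set Implicit Arguments. Unset Strict Implicit. Unset Printing Implicit Defensive.
Import GRing.Theory.
Local Open Scope ring_scope.

(* Write a point of the incidence variety as [x = y + t (y - A)] with [y] on the curve
   and [t ^ 2 |y - A| ^ 2 = d ^ 2]: it is a double cover of the open part of the curve
   where [|y - A| ^ 2 != 0], with covering involution [t -> - t].  If a polynomial vanishes on an
   infinite subset of the cover, then its norm, a polynomial in [y], vanishes at infinitely
   many points of the irreducible curve and hence on all of it.  Therefore an infinite
   closed subset together with its conjugate is the whole cover, which yields one
   or two components, all of dimension 1.  Their images have dimension at most 1 because
   a second norm gives a nonzero polynomial vanishing on the conchoid; a component can only
   be contracted to a point when the curve is the circle centered at [A]. *)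

(** * Plane curves without common components *)

Section BivariatePolynomials.
Variable K : closedFieldType.
Implicit Types (F G H U V : {poly {poly K}}) (c : {poly K}).

(** The inner variable is the first coordinate and the outer one the second: [F.[y%:P].[x]] is the
    value at (x, y), and [spec x F] is the restriction of [F] to the vertical line over x. *)
Definition spec (x : K) : {poly {poly K}} -> {poly K} := map_poly (horner_eval x).
HB.instance Definition _ x := GRing.RMorphism.on (spec x).

Lemma specE x F y : (spec x F).[y] = F.[y%:P].[x].
Proof.
by rewrite /spec -{1}[y](hornerC y x) -[(y%:P).[x]]/(horner_eval x y%:P) horner_map.
Qed.

Lemma spec_eq0 x F : spec x F = 0 -> exists G, F = ('X - x%:P)%:P * G.
Proof.
move=> F0; exists (\poly_(i < size F) (F`_i %/ ('X - x%:P))).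
apply/polyP => i; rewrite coefCM coef_poly.
case: ltnP => [_|hi]; last by rewrite mulr0 nth_default.
rewrite mulrC divpK // dvdp_XsubCl /root.
by have /(congr1 (fun p : {poly K} => p`_i)) := F0; rewrite coef_map coef0 => /eqP.
Qed.

Lemma spec_XsubC x : spec x ('X - x%:P)%:P = 0.
Proof. by rewrite /spec map_polyC /= /horner_eval hornerXsubC subrr polyC0. Qed.

(* Gauss' lemma: over an algebraically closed field the primes of [K[X]] are linear,
   so the roots of the content [c] are cancelled one at a time. *)
Lemma Gauss_factor c F G U : c != 0 -> c%:P * F = G * U ->
  exists e G' U', [/\ e != 0, G = e%:P * G' & F = G' * U'].
Proof.
move: {2}(size c) (leqnn (size c)) => n; elim: n c G U => [|n IHn] c G U sc c0 E.
  by move: sc; rewrite leqn0 size_poly_eq0 (negPf c0).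
have [/size_poly1P [k k0 Ec]|/closed_rootP [x /factor_theorem [c1 Ec]]] := boolP (size c == 1%N).
  exists 1, G, (k^-1%:P%:P * U); rewrite oner_neq0 mul1r; split => //.
  rewrite mulrCA -E Ec mulrA -!polyCM mulVf //.
  by rewrite mul1r.
have c10 : c1 != 0 by apply: contraNneq c0; rewrite Ec => ->; rewrite mul0r.
have sc1 : (size c1 <= n)%N.
  by move: sc; rewrite Ec size_Mmonic ?monicXsubC // size_XsubC addn2.
have Xx0 : ('X - x%:P)%:P != 0 :> {poly {poly K}} by rewrite polyC_eq0 polyXsubC_eq0.
have : spec x G * spec x U = 0.
  by rewrite -[LHS](rmorphM (spec x)) -E Ec polyCM !(rmorphM (spec x)) /= spec_XsubC mulr0 mul0r.
move/eqP; rewrite mulf_eq0 => /orP [] /eqP/spec_eq0 [G1 EG1].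
  have /(IHn _ _ _ sc1 c10) [e [G' [U' [e0 E1 E2]]]] : c1%:P * F = G1 * U.
    by apply: (mulfI Xx0); rewrite mulrA -polyCM mulrC -[_ * c1]mulrC -Ec mulrC E EG1 mulrA.
  exists (('X - x%:P) * e), G', U'; split => //; first by rewrite mulf_neq0 ?polyXsubC_eq0.
  by rewrite EG1 E1 polyCM mulrA.
apply: (IHn _ G G1 sc1 c10).
by apply: (mulfI Xx0); rewrite mulrA -polyCM [_ * c1]mulrC -Ec E EG1 mulrCA.
Qed.

Lemma irreducible_nonfactor (R : idomainType) (p g h : R) :
  (forall u v : R, p = u * v -> u \is a GRing.unit \/ v \is a GRing.unit) ->
  p = g * h -> g \isn't a GRing.unit -> exists2 k, k \is a GRing.unit & g = p * k.
Proof.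
move=> irr E /negP ng; have [//|uh] := irr _ _ E.
by exists h^-1; rewrite ?unitrV // E mulrK.
Qed.

Lemma roots_list (p : {poly K}) : p != 0 -> exists s : seq K, forall x, p.[x] = 0 -> x \in s.
Proof.
move=> p0; have [s Es] := closed_field_poly_normal p; exists s => x /eqP.
by rewrite Es hornerZ mulf_eq0 lead_coef_eq0 (negPf p0) -[_ == 0]/(root _ x) root_prod_XsubC.
Qed.

Section CoprimeCurves.
Variable F : {poly {poly K}}.
Hypothesis F0 : F != 0.
Hypothesis Fnu : F \isn't a GRing.unit.
Hypothesis Firr :
  forall g h, F = g * h -> g \is a GRing.unit \/ h \is a GRing.unit.

(** Gauss's lemma writes [F] as a polynomial in the inner variable times a divisor of [H]. This
    divisor is not a unit because [F] has positive degree in the outer variable, so it is associate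
    to [F]. *)
Lemma dvd_of_multiple c H V : c != 0 -> (1 < size F)%N -> c%:P * H = F * V ->
  exists W, H = F * W.
Proof.
move=> c0 sF /(Gauss_factor c0) [e [G [U [e0 EF EH]]]].
have [k _ Ek] : exists2 k, k \is a GRing.unit & G = F * k.
  apply: (irreducible_nonfactor Firr (h := e%:P)); first by rewrite mulrC.
  apply/negP; rewrite poly_unitE => /andP [sG _].
  by move: sF; rewrite EF size_Cmul // (eqP sG).
by exists (k * U); rewrite EH Ek mulrA.
Qed.

(** [c] is the resultant with respect to the outer variable, or [F] or [H] itself when that one does
    not involve the outer variable. *)
Lemma eliminant H : (forall W, H <> F * W) ->
  exists c, c != 0 /\ forall x y, F.[y%:P].[x] = 0 -> H.[y%:P].[x] = 0 -> c.[x] = 0.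
Proof.
move=> ndv.
have [sF|sF] := leqP (size F) 1.
  exists F`_0; rewrite {2}(size1_polyC sF); split; last by move=> x y; rewrite hornerC.
  by apply: contra F0 => /eqP E; rewrite (size1_polyC sF) E.
have [sH|sH] := leqP (size H) 1.
  exists H`_0; rewrite {2}(size1_polyC sH); split; last by move=> x y _; rewrite hornerC.
  apply/eqP => E; apply: (ndv 0); rewrite mulr0.
  by rewrite (size1_polyC sH) E.
have [r0|r0] := eqVneq (resultant F H) 0; last first.
  have [[u v] /= _ E] := resultant_in_ideal sF sH.
  exists (resultant F H); split => // x y Fx Hx.
  have /(congr1 (fun P : {poly {poly K}} => P.[y%:P].[x])) := E.
  by rewrite hornerC hornerD !hornerM hornerD !hornerM Fx Hx !mulr0 addr0.
(* A zero resultant means a gcd of positive degree. By Gauss's lemma it is a multiple of a nonunit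
   divisor of [F], hence of [F], and so [F] divides [H]. *)
exfalso.
move/eqP: r0; rewrite resultant_eq0; set G := gcdp F H => sG.
have /Pdiv.Idomain.dvdpP [[c U] /= c0 EF] : Pdiv.Field.dvdp G F by apply: Pdiv.Idomain.dvdp_gcdl.
have /Pdiv.Idomain.dvdpP [[c' V] /= c'0 EH] : Pdiv.Field.dvdp G H by apply: Pdiv.Idomain.dvdp_gcdr.
have /(Gauss_factor c0) [e [G' [U' [e0 EG EF']]]] : c%:P * F = G * U.
  by rewrite mul_polyC EF mulrC.
have [k _ Ek] : exists2 k, k \is a GRing.unit & G' = F * k.
  apply: (irreducible_nonfactor Firr EF').
  apply/negP; rewrite poly_unitE => /andP [sG' _].
  by move: sG; rewrite EG size_Cmul // (eqP sG').
have [W EW] : exists W, H = F * W.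
  apply: (@dvd_of_multiple c' H (V * e%:P * k)) => //.
  by rewrite mul_polyC EH EG Ek; ring.
exact: ndv EW.
Qed.

(** If both restrictions vanished, X - x would divide [F] and [H]; the irreducible [F] would be
    associate to X - x and divide [H]. *)
Lemma spec_neq0 x H : (forall W, H <> F * W) -> spec x F != 0 \/ spec x H != 0.
Proof.
move=> ndv; have [/spec_eq0 [F1 E1]|] := eqVneq (spec x F) 0; last by left.
right; apply/eqP => /spec_eq0 [H1 EH].
have [k _ Ek] : exists2 k, k \is a GRing.unit & ('X - x%:P)%:P = F * k.
  apply: (irreducible_nonfactor Firr E1).
  rewrite poly_unitE size_polyC polyXsubC_eq0 /= coefC /= poly_unitE size_XsubC.
  by [].
by apply: (ndv (k * H1)); rewrite EH Ek mulrA.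
Qed.

(** The eliminant leaves finitely many vertical lines, and on each of them [F] or [H] is a nonzero
    polynomial in one variable. *)
Lemma finite_common_zeros H : (forall W, H <> F * W) ->
  exists s : seq (K * K), forall x y, F.[y%:P].[x] = 0 -> H.[y%:P].[x] = 0 -> (x, y) \in s.
Proof.
move=> ndv; have [c [c0 Ec]] := eliminant ndv.
have [r Er] := roots_list c0.
suff [s Es] : exists s : seq (K * K), forall x y, x \in r ->
    F.[y%:P].[x] = 0 -> H.[y%:P].[x] = 0 -> (x, y) \in s.
  by exists s => x y Fx Hx; apply: Es => //; apply: Er; apply: Ec Fx Hx.
elim: r {Er} => [|x0 r [s Es]]; first by exists [::].
have [t Et] : exists t : seq K, forall y, F.[y%:P].[x0] = 0 -> H.[y%:P].[x0] = 0 -> y \in t.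
  have [/roots_list|/roots_list] := spec_neq0 x0 ndv => -[t Et]; exists t => y.
    by rewrite -specE => Fx _; apply: Et.
  by rewrite -[H.[_].[_]]specE => _ Hx; apply: Et.
exists ([seq (x0, y) | y <- t] ++ s) => x y.
rewrite inE mem_cat => /orP [/eqP -> Fx Hx|xr Fx Hx]; last by rewrite Es ?orbT.
by rewrite map_f // Et.
Qed.

(** If [F] does not involve the outer variable, it vanishes on a whole vertical line; otherwise all
    but finitely many vertical lines carry a zero. *)
Lemma infinitely_many_zeros (s : seq (K * K)) :
  exists x y, F.[y%:P].[x] = 0 /\ (x, y) \notin s.
Proof.
have [sF|sF] := leqP (size F) 1.
  have EF := size1_polyC sF.
  have /closed_rootP [x x0] : size F`_0 != 1%N.
    apply: contra Fnu => /size_poly1P [k k0 Ek].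
    by rewrite EF Ek rmorph_unit // rmorph_unit // unitfE.
  pose p := \prod_(z <- s) ('X - z.2%:P).
  have /closed_nonrootP [y yp] : p != 0 by exact: monic_neq0 (monic_prod_XsubC _ _ _).
  exists x, y; rewrite {1}EF hornerC; split; first exact/eqP.
  apply: contra yp => xy; rewrite /p (big_rem _ xy) /= rootM.
  by rewrite /root hornerXsubC subrr eqxx.
(* A nonroot of [p] avoids the first coordinates of [s] and keeps the degree of [spec x F]
   positive. *)
pose p := lead_coef F * \prod_(z <- s) ('X - z.1%:P).
have /closed_nonrootP [x] : p != 0.
  by rewrite mulf_neq0 ?lead_coef_eq0 ?(monic_neq0 (monic_prod_XsubC _ _ _)).
rewrite rootM negb_or => /andP [lx sx].
have /closed_rootP [y y0] : size (spec x F) != 1%N.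
  by rewrite /spec size_map_poly_id0 ?neq_ltn ?sF ?orbT.
exists x, y; rewrite -specE; split; first exact/eqP.
apply: contra sx => xy; rewrite (big_rem _ xy) /= rootM.
by rewrite /root hornerXsubC subrr eqxx.
Qed.

End CoprimeCurves.

Lemma nonvanishing_point F : F != 0 -> exists x y, F.[y%:P].[x] != 0.
Proof.
rewrite -lead_coef_eq0 => /closed_nonrootP [x lx].
have /closed_nonrootP [y yp] : spec x F != 0.
  apply/eqP => /polyP /(_ (size F).-1) /eqP.
  by rewrite coef_map coef0; apply/negP.
by exists x, y; rewrite -specE.
Qed.

End BivariatePolynomials.

(** * Transfer from iterated polynomials to polynomials in two variables *)

Section PlaneCurves.
Variable K : closedFieldType.
Implicit Types (f g h : {mpoly K[2]}) (p : pt K 2).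

Lemma c2_mk (x y : K) : (c2 (mkpt2 x y) 0 = x) * (c2 (mkpt2 x y) 1 = y).
Proof. by rewrite /c2 /mkpt2 !mxE !inordK. Qed.

Lemma mk_c2 p : p = mkpt2 (c2 p 0) (c2 p 1).
Proof.
apply/rowP => i; rewrite mxE /c2.
by case: eqP => i0; congr (p _ _); apply/val_inj; rewrite /= inordK //; case: i i0 => [[|[|]]].
Qed.

(** A ring isomorphism onto K[X][Y] that respects evaluation, so that resultants and Gauss's lemma
    apply to plane curves. *)
Definition to_bivariate : {mpoly K[2]} -> {poly {poly K}} :=
  mmap (@polyC {poly K} \o @polyC K) (fun i : 'I_2 => if i == 0%N :> nat then 'X%:P else 'X).
HB.instance Definition _ := GRing.RMorphism.on to_bivariate.

Definition of_bivariate : {poly {poly K}} -> {mpoly K[2]} :=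
  horner_eval 'X_(inord 1) \o map_poly (horner_alg ('X_(inord 0))).
HB.instance Definition _ := GRing.RMorphism.on of_bivariate.

Lemma inord01 (i : 'I_2) : i = if i == 0%N :> nat then inord 0 else inord 1.
Proof. by case: ifP => i0; apply/val_inj; rewrite /= inordK //; case: i i0 => [[|[|]]]. Qed.

Lemma to_bivariateE f (x y : K) : (to_bivariate f).[y%:P].[x] = peval f (mkpt2 x y).
Proof.
rewrite /peval mevalE /to_bivariate /mmap !horner_sum; apply: eq_bigr => m _.
rewrite !hornerM /= !hornerC; congr (_ * _).
rewrite /mmap1 !horner_prod; apply: eq_bigr => i _.
by rewrite !horner_exp /mkpt2 mxE; case: ifP => _; rewrite ?hornerX ?hornerC ?hornerX.
Qed.

Lemma of_bivariateC (c : K) : of_bivariate c%:P%:P = c%:MP.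
Proof.
by rewrite /of_bivariate /= map_polyC /= /horner_eval hornerC horner_algC -mul_mpolyC mulr1.
Qed.

Lemma of_bivariateX : of_bivariate 'X%:P = 'X_(inord 0).
Proof. by rewrite /of_bivariate /= map_polyC /= /horner_eval hornerC horner_algX. Qed.

Lemma of_bivariateY : of_bivariate 'X = 'X_(inord 1).
Proof. by rewrite /of_bivariate /= map_polyX /horner_eval hornerX. Qed.

Lemma to_bivariateK : cancel to_bivariate of_bivariate.
Proof.
move=> f; rewrite [RHS]mpolyE /to_bivariate /mmap rmorph_sum; apply: eq_bigr => m _.
rewrite rmorphM -mul_mpolyC; congr (_ * _); first exact: of_bivariateC.
rewrite mpolyXE_id rmorph_prod; apply: eq_bigr => i _; rewrite rmorphXn; congr (_ ^+ _).
by rewrite [in RHS](inord01 i); case: ifP => _; [exact: of_bivariateX | exact: of_bivariateY].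
Qed.

Lemma of_bivariateK : cancel of_bivariate to_bivariate.
Proof.
elim/poly_ind => [|F c IH]; first by rewrite !rmorph0.
rewrite !rmorphD !rmorphM /= IH of_bivariateY /to_bivariate mmapX mmap1U inordK //=.
congr (_ + _); rewrite -/to_bivariate.
elim/poly_ind: c => [|p c IHc]; first by rewrite !rmorph0.
rewrite polyCD polyCM !rmorphD !rmorphM /= IHc of_bivariateX of_bivariateC.
by rewrite /to_bivariate mmapX mmap1U inordK //= mmapC.
Qed.

Lemma bivariate_irreducible f : irreducible_mpoly f ->
  [/\ to_bivariate f != 0, to_bivariate f \isn't a GRing.unit &
      forall G H, to_bivariate f = G * H -> G \is a GRing.unit \/ H \is a GRing.unit].
Proof.
have unitB G : of_bivariate G \is a GRing.unit -> G \is a GRing.unit.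
  by move=> uG; rewrite -[G]of_bivariateK rmorph_unit.
case=> f0 fnu firr; split.
- by apply: contra f0 => /eqP E; rewrite -[f]to_bivariateK E rmorph0.
- by apply: contra fnu => uf; rewrite -[f]to_bivariateK rmorph_unit.
move=> G H E; have /firr [] : f = of_bivariate G * of_bivariate H.
- by rewrite -[LHS]to_bivariateK E rmorphM.
- by left; apply: unitB.
- by right; apply: unitB.
Qed.

Lemma curves_meet_finitely f h : irreducible_mpoly f -> (forall k, h <> f * k) ->
  exists s : seq (pt K 2), forall p, peval f p = 0 -> peval h p = 0 -> p \in s.
Proof.
move=> /bivariate_irreducible [f0 fnu firr] ndv.
have [|s Es] := @finite_common_zeros K (to_bivariate f) f0 firr (to_bivariate h).
  move=> W E; apply: (ndv (of_bivariate W)).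
  by rewrite -[h]to_bivariateK E rmorphM /= to_bivariateK.
exists [seq mkpt2 z.1 z.2 | z <- s] => p; rewrite (mk_c2 p) -!to_bivariateE => fp hp.
by apply: (map_f (fun z => mkpt2 z.1 z.2) (Es _ _ fp hp)).
Qed.

Lemma curve_infinite f (s : seq (pt K 2)) : irreducible_mpoly f ->
  exists2 p, peval f p = 0 & p \notin s.
Proof.
move=> /bivariate_irreducible [f0 fnu firr].
have [x [y [fxy xys]]] :=
  infinitely_many_zeros f0 fnu [seq (c2 p 0, c2 p 1) | p <- s].
exists (mkpt2 x y); first by rewrite -to_bivariateE.
apply: contra xys => xys; apply/mapP; exists (mkpt2 x y) => //.
by rewrite !c2_mk.
Qed.

Lemma mpoly_nonvanishing f : f != 0 -> exists p, peval f p != 0.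
Proof.
move=> f0; have [|x [y fxy]] := @nonvanishing_point K (to_bivariate f).
  by apply: contra f0 => /eqP E; rewrite -[f]to_bivariateK E rmorph0.
by exists (mkpt2 x y); rewrite -to_bivariateE.
Qed.

End PlaneCurves.

(** * The Zariski topology *)

Section PolynomialFunctions.
Variables (K : fieldType) (n : nat).
Implicit Types (u v : pt K n -> K).

Definition polyfun u := exists p, forall x, peval p x = u x.

Lemma polyfun_const c : polyfun (fun=> c).
Proof. by exists c%:MP => x; rewrite /peval mevalC. Qed.

Lemma polyfun_coord i : polyfun (fun x => x ord0 i).
Proof. by exists 'X_i => x; rewrite /peval mevalXU. Qed.

Lemma polyfunD u v : polyfun u -> polyfun v -> polyfun (fun x => u x + v x).
Proof. by move=> [p Ep] [q Eq]; exists (p + q) => x; rewrite /peval mevalD -Ep -Eq. Qed.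

Lemma polyfunM u v : polyfun u -> polyfun v -> polyfun (fun x => u x * v x).
Proof. by move=> [p Ep] [q Eq]; exists (p * q) => x; rewrite /peval mevalM -Ep -Eq. Qed.

Lemma polyfunN u : polyfun u -> polyfun (fun x => - u x).
Proof. by move=> [p Ep]; exists (- p) => x; rewrite /peval mevalN -Ep. Qed.

Lemma polyfunB u v : polyfun u -> polyfun v -> polyfun (fun x => u x - v x).
Proof. by move=> up vp; apply: polyfunD => //; apply: polyfunN. Qed.

Lemma polyfunX u k : polyfun u -> polyfun (fun x => u x ^+ k).
Proof. by move=> [p Ep]; exists (p ^+ k) => x; rewrite /peval rmorphXn /= -Ep. Qed.

End PolynomialFunctions.

(** Induction on how a polynomial is built. It is applied to polynomial functions, to quadratic
    functions, to Laurent polynomials and to restrictions to a line. Closure under pointwise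
    equality stands in for functional extensionality. *)
Lemma peval_ind (K : fieldType) n (T : Type) (Q : (T -> K) -> Prop) (v : T -> pt K n) :
  (forall c, Q (fun=> c)) ->
  (forall u w, Q u -> Q w -> Q (fun t => u t + w t)) ->
  (forall u w, Q u -> Q w -> Q (fun t => u t * w t)) ->
  (forall u w, (forall t, u t = w t) -> Q u -> Q w) ->
  (forall i, Q (fun t => v t ord0 i)) ->
  forall p : {mpoly K[n]}, Q (fun t => peval p (v t)).
Proof.
move=> Qc QD QM Qe Qv p.
apply: (Qe (fun t => \sum_(m <- msupp p) p@_m * \prod_i (v t) ord0 i ^+ m i)).
  by move=> t; rewrite /peval mevalE.
elim: (msupp p) => [|m s IH].
  by apply: Qe (Qc 0) => t; rewrite big_nil.
have Qprod (r : seq 'I_n) : Q (fun t => \prod_(i <- r) (v t) ord0 i ^+ m i).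
  elim: r => [|i r IHr]; first by apply: Qe (Qc 1) => t; rewrite big_nil.
  have Qpow k : Q (fun t => (v t) ord0 i ^+ k).
    elim: k => [|k IHk]; first by apply: Qe (Qc 1) => t; rewrite expr0.
    by apply: Qe (QM _ _ (Qv i) IHk) => t; rewrite exprS.
  by apply: Qe (QM _ _ (Qpow (m i)) IHr) => t; rewrite big_cons.
apply: Qe (QD _ _ (QM _ _ (Qc p@_m) (Qprod (index_enum _))) IH) => t.
by rewrite big_cons.
Qed.

Lemma polyfun_comp (K : fieldType) n m (v : pt K n -> pt K m) (p : {mpoly K[m]}) :
  (forall i, polyfun (fun x => v x ord0 i)) -> polyfun (fun x => peval p (v x)).
Proof.
move=> vp; apply: (peval_ind (Q := @polyfun K n)) => //.
- exact: polyfun_const.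
- exact: polyfunD.
- exact: polyfunM.
- by move=> u w E [q Eq]; exists q => x; rewrite Eq.
Qed.

(** * Closed sets, closures and irreducible components *)

Section ZariskiTopology.
Variable K : fieldType.
Implicit Types n m : nat.

(** Any system defining [Z] lies in the ideal of [Z], so this ideal defines [Z] as well. No
    equations then have to be named for intersections, preimages and closures. *)
Lemma zclosedP n (Z : pset K n) : zclosed Z <->
  (forall x, (forall p, (forall z, Z z -> peval p z = 0) -> peval p x = 0) -> Z x).
Proof.
split=> [[S ES] x Hx|H].
  by apply/ES => p Sp; apply: Hx => z /ES; apply.
exists (fun p => forall z, Z z -> peval p z = 0) => x; split => [Zx p|]; first exact.
exact: H.
Qed.

Lemma zclosed_separate n (Z : pset K n) x : zclosed Z -> ~ Z x ->
  exists2 p, (forall z, Z z -> peval p z = 0) & peval p x != 0.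
Proof.
move=> /zclosedP cZ nZx; apply: NNPP => nex; apply: nZx; apply: cZ => p Zp.
by apply/eqP; apply/negPn/negP => px; apply: nex; exists p.
Qed.

Lemma eq_zclosed n (Z Z' : pset K n) : pseteq Z Z' -> zclosed Z -> zclosed Z'.
Proof. by move=> E [S ES]; exists S => x; rewrite -ES; split=> /E. Qed.

Lemma zclosed_eq0 n (u : pt K n -> K) : polyfun u -> zclosed (fun x => u x = 0).
Proof.
move=> [p Ep]; exists (fun q => q = p) => x; rewrite /zero_set -Ep.
by split=> [px _ ->|]; last apply.
Qed.

Lemma zclosed_eq n (u v : pt K n -> K) : polyfun u -> polyfun v ->
  zclosed (fun x => u x = v x).
Proof.
move=> up vp; apply: eq_zclosed (zclosed_eq0 (polyfunB up vp)) => x.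
by split=> [/eqP|->]; rewrite ?subrr // subr_eq0 => /eqP.
Qed.

Lemma zclosed0 n : zclosed (fun _ : pt K n => False).
Proof.
exists (fun p => p = 1) => x; split=> // /(_ 1 erefl).
by rewrite /peval meval1 => /eqP; rewrite oner_eq0.
Qed.

Lemma zclosedI n (I : Type) (Z : I -> pset K n) :
  (forall i, zclosed (Z i)) -> zclosed (fun x => forall i, Z i x).
Proof.
move=> cZ; apply/zclosedP => x Hx i; move/zclosedP: (cZ i); apply=> p Zp.
by apply: Hx => z /(_ i); apply: Zp.
Qed.

Lemma zclosedI2 n (Z Z' : pset K n) :
  zclosed Z -> zclosed Z' -> zclosed (fun x => Z x /\ Z' x).
Proof.
move=> /zclosedP cZ /zclosedP cZ'; apply/zclosedP => x Hx.
by split; [apply: cZ | apply: cZ'] => p Zp; apply: Hx => z []; auto.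
Qed.

Lemma zclosedU n (Z Z' : pset K n) :
  zclosed Z -> zclosed Z' -> zclosed (fun x => Z x \/ Z' x).
Proof.
move=> cZ cZ'; apply/zclosedP => x Hx; apply: NNPP => /not_or_and [nZ nZ'].
have [p Zp px] := zclosed_separate cZ nZ.
have [q Zq qx] := zclosed_separate cZ' nZ'.
have /eqP : peval (p * q) x = 0.
  by apply: Hx => z; rewrite /peval mevalM => -[/Zp|/Zq]; rewrite /peval => ->;
     rewrite ?mul0r ?mulr0.
by rewrite /peval mevalM mulf_eq0 (negPf px) (negPf qx).
Qed.

Lemma zclosed1 n (x0 : pt K n) : zclosed (fun x => x = x0).
Proof.
have H i : zclosed (fun x : pt K n => x ord0 i = x0 ord0 i).
  by apply: zclosed_eq; [exact: polyfun_coord | exact: polyfun_const].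
apply: eq_zclosed (zclosedI H) => x; split=> [E|-> //].
by apply/rowP => i; apply: E.
Qed.

Lemma zclosed_seq n (s : seq (pt K n)) : zclosed (fun x => x \in s).
Proof.
elim: s => [|y s IH]; first exact: eq_zclosed (zclosed0 n).
apply: eq_zclosed (zclosedU (zclosed1 y) IH) => x; rewrite inE.
by split=> [[->|->]|/orP [/eqP|]]; rewrite ?eqxx ?orbT; auto.
Qed.

Lemma zclosed_preimage n m (v : pt K n -> pt K m) (Z : pset K m) :
  (forall i, polyfun (fun x => v x ord0 i)) -> zclosed Z -> zclosed (fun x => Z (v x)).
Proof.
move=> vp cZ; apply/zclosedP => x Hx; move/zclosedP: (cZ); apply=> p Zp.
have [q Eq] := polyfun_comp p vp.
by rewrite -Eq; apply: Hx => z Zz; rewrite Eq; apply: Zp.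
Qed.

Lemma zclosure_closed n (A : pset K n) : zclosed (zclosure A).
Proof.
apply/zclosedP => x Hx Z cZ AZ; move/zclosedP: (cZ); apply=> p Zp.
by apply: Hx => z Az; apply: Zp; apply: Az.
Qed.

Lemma sub_zclosure n (A : pset K n) : psubset A (zclosure A).
Proof. by move=> x Ax Z _; apply. Qed.

Lemma zclosure_min n (A Z : pset K n) : zclosed Z -> psubset A Z -> psubset (zclosure A) Z.
Proof. by move=> cZ AZ x /(_ Z cZ AZ). Qed.

(** A closed cover of the image pulls back to a closed cover of [Y]. *)
Lemma zirreducible_image n m (v : pt K n -> pt K m) (Y : pset K n) :
  (forall i, polyfun (fun x => v x ord0 i)) -> zirreducible Y ->
  zirreducible (zclosure (fun y => exists x, Y x /\ y = v x)).
Proof.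
move=> vp [[x Yx] irr]; split; first by exists (v x); apply: sub_zclosure; exists x.
move=> Z1 Z2 c1 c2 sub.
case: (irr _ _ (zclosed_preimage vp c1) (zclosed_preimage vp c2)) => [z Yz|H|H].
- by apply: sub; apply: sub_zclosure; exists z.
- by left; apply: zclosure_min => // _ [z [Yz ->]]; apply: H.
- by right; apply: zclosure_min => // _ [z [Yz ->]]; apply: H.
Qed.

Lemma zirreducible_point n (Y : pset K n) x : Y x -> (forall z, Y z -> z = x) -> zirreducible Y.
Proof.
move=> Yx Y1; split; first by exists x.
move=> Z1 Z2 _ _ sub; case: (sub x Yx) => Zx; [left|right] => z /Y1 ->; exact: Zx.
Qed.

(** By irreducibility a component lies in one of the two closed pieces; by maximality it equals that
    piece. *)
Lemma irr_component_of_cover n (X Y1 Y2 Y : pset K n) :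
  zirreducible Y1 -> zirreducible Y2 -> zclosed Y1 -> zclosed Y2 ->
  psubset Y1 X -> psubset Y2 X -> psubset X (fun x => Y1 x \/ Y2 x) ->
  irr_component X Y -> pseteq Y Y1 \/ pseteq Y Y2.
Proof.
move=> i1 i2 c1 c2 s1 s2 cov [YX iY maxY].
have [x /YX/cov//|H|H] := iY.2 _ _ c1 c2.
- by left => x; split; [apply: H | apply: maxY].
- by right => x; split; [apply: H | apply: maxY].
Qed.

Lemma eq_zdim n (Y Y' : pset K n) k : pseteq Y Y' -> zdim_eq Y k -> zdim_eq Y' k.
Proof.
have ch (X X' : pset K n) j : pseteq X X' -> has_chain X j -> has_chain X' j.
  move=> E [Z [H1 H2]]; exists Z; split=> // i /H1 [? ? sub]; split=> // x /sub /E.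
  exact.
move=> E [h1 h2]; split; first exact: ch h1.
by move=> h; apply: h2; apply: ch h => x; split=> /E.
Qed.

(** * Finite sets and dimension one *)

Definition finite_pset n (A : pset K n) := exists s : seq (pt K n), forall x, A x -> x \in s.

Lemma finite_psetS n (A B : pset K n) : psubset A B -> finite_pset B -> finite_pset A.
Proof. by move=> AB [s Hs]; exists s => x /AB/Hs. Qed.

Lemma finite_psetU n (A B : pset K n) :
  finite_pset A -> finite_pset B -> finite_pset (fun x => A x \/ B x).
Proof.
by move=> [s Hs] [t Ht]; exists (s ++ t) => x; rewrite mem_cat => -[/Hs->|/Ht->]; rewrite ?orbT.
Qed.

Lemma finite_psetU_inv n (A B C : pset K n) : ~ finite_pset A ->
  psubset A (fun x => B x \/ C x) ->
  ~ finite_pset (fun x => A x /\ B x) \/ ~ finite_pset (fun x => A x /\ C x).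
Proof.
move=> iA sub; apply: NNPP => /not_or_and [/NNPP fB /NNPP fC]; apply: iA.
by apply: finite_psetS (finite_psetU fB fC) => x Ax; case: (sub x Ax); [left|right].
Qed.

Lemma finite_fibers n m (v : pt K n -> pt K m) (A : pset K n) (s : seq (pt K m)) :
  (forall y, finite_pset (fun x => A x /\ v x = y)) -> (forall x, A x -> v x \in s) ->
  finite_pset A.
Proof.
move=> ff; elim: s A ff => [|y s IH] A ff sub; first by exists [::] => x /sub.
apply: finite_psetS (finite_psetU (ff y) (IH (fun x => A x /\ v x \in s) _ _)).
- by move=> x Ax; move: (sub x Ax); rewrite inE => /orP [/eqP|]; auto.
- by move=> z; apply: finite_psetS (ff z) => x [[]].
- by move=> x [].
Qed.

(** Points are closed, so irreducibility allows discarding listed points one at a time until a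
    single one is left. *)
Lemma zirreducible_finite n (Y : pset K n) : zirreducible Y -> finite_pset Y ->
  exists x, pseteq Y (fun z => z = x).
Proof.
move=> [[x Yx] irr] [s]; elim: s => [|y s IH] Hs; first by have := Hs x Yx.
have [z Yz|H|//] := irr _ _ (zclosed1 y) (zclosed_seq s).
- by move: (Hs z Yz); rewrite inE => /orP [/eqP|]; auto.
- by exists y => z; split=> [|->]; [exact: H | rewrite -(H x Yx)].
Qed.

Lemma zirreducible_infinite n (Y Y' : pset K n) : zirreducible Y' ->
  (exists x, Y x) -> psubset Y Y' -> ~ psubset Y' Y -> ~ finite_pset Y'.
Proof.
move=> irr [x Yx] sub nsub /(zirreducible_finite irr) [z Ez]; apply: nsub => t /Ez ->.
by rewrite -((Ez x).1 (sub x Yx)).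
Qed.

(* A chain of length 2 has an infinite middle term, hence the criterion. *)
Lemma zdim1P n (Y : pset K n) : zclosed Y -> zirreducible Y -> ~ finite_pset Y ->
  (forall Z Z', zclosed Z -> zclosed Z' -> zirreducible Z -> zirreducible Z' ->
     ~ finite_pset Z -> psubset Z Z' -> psubset Z' Y -> psubset Z' Z) ->
  zdim_eq Y 1.
Proof.
move=> cY iY infY H; split.
  have [[x Yx] _] := iY.
  exists (fun i => if i is 0 then (fun z => z = x) else Y); split=> [[|[|//]]|[|//]] _.
  - split; [exact: zclosed1 | exact: (@zirreducible_point _ _ x) | by move=> z ->].
  - by split.
  - split=> [z -> //|sub]; apply: infY; exists [:: x] => z /sub ->.
    by rewrite inE.
move=> [Z [H1 H2]].
have [c0 i0 s0] := H1 0 isT; have [c1 i1 s1] := H1 1 isT; have [c2 i2 s2] := H1 2 isT.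
have [s01 n01] := H2 0 isT; have [s12 n12] := H2 1 isT.
by apply: n12; apply: H => //; apply: (@zirreducible_infinite _ (Z 0)) => //; case: i0.
Qed.

End ZariskiTopology.

(** * Double covers of curves *)

(* Here [s] is an involution of [X] for which every infinite closed subset of [X]
   dominates the quotient [X / s]: this is how a double cover of an irreducible curve
   is used, and it makes dimension theory unnecessary. *)
Section DoubleCover.
Variables (K : fieldType) (n : nat) (X : pset K n) (s : pt K n -> pt K n).
Hypothesis Xclosed : zclosed X.
Hypothesis Xinf : ~ finite_pset X.
Hypothesis sK : involutive s.
Hypothesis s_poly : forall i, polyfun (fun x => s x ord0 i).
Hypothesis dominant : forall Z, zclosed Z -> psubset Z X -> ~ finite_pset Z ->
  forall x, X x -> Z x \/ Z (s x).

(** If [X] has no proper infinite closed subset, [X] itself is irreducible. Otherwise let [Z] be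
    one: its part stable under [s] is finite, and the closure of the remaining part is the
    irreducible set sought. *)
Lemma double_cover_component :
  exists G, [/\ zclosed G, zirreducible G, ~ finite_pset G, psubset G X &
    forall x, X x -> G x \/ G (s x)].
Proof.
have [[Z [v [cZ ZX infZ Xv nZv]]]|noZ] := classic (exists Z v,
  [/\ zclosed Z, psubset Z X, ~ finite_pset Z, X v & ~ Z v]); last first.
  have [v Xv] : exists v, X v.
    apply: NNPP => nX; apply: Xinf; exists [::] => x Xx.
    by case: nX; exists x.
  exists X; split=> //; last by left.
  split; first by exists v.
  move=> Z1 Z2 c1 c2 sub.
  have full Z : zclosed Z -> ~ finite_pset (fun x => X x /\ Z x) -> psubset X Z.
    move=> cZ inf x Xx; apply: NNPP => nZx; apply: noZ.
    exists (fun x => X x /\ Z x), x; split=> //; first exact: zclosedI2.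
    - by move=> z [].
    - by move=> [].
  by have [inf|inf] := finite_psetU_inv Xinf sub; [left|right]; apply: full.
pose E := fun x => Z x /\ Z (s x); pose D := fun x => Z x /\ ~ Z (s x).
have finE : finite_pset E.
  apply: NNPP => infE; apply: nZv.
  (* Were [E] infinite, it would contain [v] or [s v]; being stable under [s], it would put [v] in
     [Z]. *)
  have cE : zclosed E by apply: zclosedI2 => //; apply: zclosed_preimage.
  by have [x []|[]|[]] := dominant cE _ infE Xv; rewrite ?sK; auto.
have DZ : psubset (zclosure D) Z by apply: zclosure_min => // x [].
have infD : ~ finite_pset (zclosure D).
  move=> finD; apply: infZ; apply: finite_psetS (finite_psetU finD finE) => x Zx.
  have [Zsx|nZsx] := classic (Z (s x)); first by right.
  by left; apply: sub_zclosure.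
have DX : psubset (zclosure D) X by move=> x /DZ/ZX.
exists (zclosure D); split=> //; first exact: zclosure_closed.
  split.
    apply: NNPP => nD; apply: infD; exists [::] => x Dx.
    by case: nD; exists x.
  move=> Z1 Z2 c1 c2 sub.
  (* By dominance an infinite closed part contains x or [s x] for each x in [D]; the second is
     excluded because [s x] is outside [Z]. So this part contains [D], hence its closure. *)
  have full W : zclosed W -> ~ finite_pset (fun x => zclosure D x /\ W x) ->
      psubset (zclosure D) W.
    move=> cW inf; apply: zclosure_min => // x [Zx nZsx].
    have := dominant (zclosedI2 (@zclosure_closed _ _ D) cW) _ inf (ZX x Zx).
    by case=> [z [/DX]|[]|[/DZ]].
  by have [inf|inf] := finite_psetU_inv infD sub; [left|right]; apply: full.
exact: (dominant (@zclosure_closed _ _ D) DX infD).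
Qed.

(** An irreducible [Z'] containing an infinite closed [Z] is covered by [Z] and its conjugate. If it
    lies in the conjugate, then x in [Z'] gives [s x] in [Z], thus in [Z'], and x = [s (s x)] is in
    [Z]. *)
Lemma double_cover_dim1 (G : pset K n) : zclosed G -> zirreducible G ->
  ~ finite_pset G -> psubset G X -> zdim_eq G 1.
Proof.
move=> cG iG infG GX; apply: zdim1P => // Z Z' cZ cZ' _ [_ iZ'] infZ sub sub'.
have [x Z'x|//|sZ x Z'x] := iZ' _ _ cZ (zclosed_preimage s_poly cZ).
  by apply: dominant => //; [move=> z /sub/sub'/GX | apply/GX/sub'].
have [//|Zsx] := dominant cZ (fun z zZ => GX z (sub' z (sub z zZ))) infZ (GX x (sub' x Z'x)).
by rewrite -[x]sK; apply/sZ/sub.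
Qed.

End DoubleCover.

(* Functions of [(z, r)] which are of the form [(P + r Q) / M ^ k], with [P] and [Q]
   polynomials in [z], on the surface [r ^ 2 * M z = e]. *)
Section Quadratic.
Variables (K : fieldType) (M : pt K 2 -> K) (e : K).
Hypothesis Mpoly : polyfun M.

Definition quadratic (u : pt K 2 * K -> K) := exists P Q k, [/\ polyfun P, polyfun Q &
  forall z r, r ^+ 2 * M z = e -> M z ^+ k * u (z, r) = P z + r * Q z].

Lemma eq_quadratic u w : (forall t, u t = w t) -> quadratic u -> quadratic w.
Proof. by move=> E [P [Q [k [pP pQ H]]]]; exists P, Q, k; split=> // z r; rewrite -E; apply: H. Qed.

Lemma quadratic_poly u : polyfun u -> quadratic (fun t => u t.1).
Proof.
move=> pu; exists u, (fun=> 0), 0; split=> //; first exact: polyfun_const.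
by move=> z r _; rewrite expr0 mul1r mulr0 addr0.
Qed.

Lemma quadratic_const c : quadratic (fun=> c).
Proof. exact: quadratic_poly (polyfun_const _ _). Qed.

Lemma quadratic_root : quadratic (fun t => t.2).
Proof.
exists (fun=> 0), (fun=> 1), 0; split; [exact: polyfun_const | exact: polyfun_const |].
by move=> z r _; rewrite expr0 mul1r mulr1 add0r.
Qed.

Lemma quadraticD u w : quadratic u -> quadratic w -> quadratic (fun t => u t + w t).
Proof.
move=> [P [Q [k [pP pQ H]]]] [P' [Q' [k' [pP' pQ' H']]]].
exists (fun z => M z ^+ k' * P z + M z ^+ k * P' z),
  (fun z => M z ^+ k' * Q z + M z ^+ k * Q' z), (k + k'); split.
- by apply: polyfunD; apply: polyfunM => //; apply: polyfunX.
- by apply: polyfunD; apply: polyfunM => //; apply: polyfunX.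
move=> z r E; transitivity (M z ^+ k' * (M z ^+ k * u (z, r)) + M z ^+ k * (M z ^+ k' * w (z, r))).
  by rewrite exprD; ring.
by rewrite H // H' //; ring.
Qed.

Lemma quadraticM u w : quadratic u -> quadratic w -> quadratic (fun t => u t * w t).
Proof.
move=> [P [Q [k [pP pQ H]]]] [P' [Q' [k' [pP' pQ' H']]]].
(* The extra factor [M] turns the term r ^ 2 Q Q' into e Q Q', hence the exponent k + k' + 1. *)
exists (fun z => M z * (P z * P' z) + e * (Q z * Q' z)),
  (fun z => M z * (P z * Q' z + Q z * P' z)), (k + k').+1; split.
- by apply: polyfunD; do 2?apply: polyfunM => //; apply: polyfun_const.
- by apply: polyfunM => //; apply: polyfunD; apply: polyfunM.
move=> z r E; transitivity (M z * ((M z ^+ k * u (z, r)) * (M z ^+ k' * w (z, r)))).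
  by rewrite exprS exprD; ring.
by rewrite H // H' // -E; ring.
Qed.

(** The product (P + r Q) (P - r Q) = P ^ 2 - r ^ 2 Q ^ 2 becomes M P ^ 2 - e Q ^ 2 after
    multiplication by [M], and r no longer occurs. *)
Lemma quadratic_norm n (v : pt K 2 * K -> pt K n) (p : {mpoly K[n]}) :
  (forall i, quadratic (fun t => v t ord0 i)) ->
  exists (h : {mpoly K[2]}) k, forall z r, r ^+ 2 * M z = e ->
    peval h z = M z ^+ k * (peval p (v (z, r)) * peval p (v (z, - r))).
Proof.
move=> vq.
have [P [Q [k [pP pQ H]]]] : quadratic (fun t => peval p (v t)).
  exact: (peval_ind quadratic_const quadraticD quadraticM eq_quadratic vq).
have [h Eh] : polyfun (fun z => M z * P z ^+ 2 - e * Q z ^+ 2).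
  apply: polyfunB; apply: polyfunM => //; try exact: polyfunX; exact: polyfun_const.
exists h, (k + k).+1 => z r E; rewrite Eh.
transitivity (M z * ((M z ^+ k * peval p (v (z, r))) * (M z ^+ k * peval p (v (z, - r))))).
  by rewrite H // H ?sqrrN // -E; ring.
by rewrite exprS exprD; ring.
Qed.

End Quadratic.

(** * Conchoids *)

Section Conchoid.
Variable K : closedFieldType.
Hypothesis charK0 : [pchar K] =i pred0.
Variables (f : {mpoly K[2]}) (a b d : K).
Hypothesis firr : irreducible_mpoly f.
Hypothesis dn0 : d != 0.
Hypothesis C0ne : exists p, curve0 f a b p.

Lemma two_neq0 : 2 != 0 :> K.
Proof. by move/pcharf0P: charK0 => ->. Qed.

Definition dist2 (p1 p2 : K) (y : pt K 2) : K := (c2 y 0 - p1) ^+ 2 + (c2 y 1 - p2) ^+ 2.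

Lemma polyfun_c2 k : polyfun (fun y : pt K 2 => c2 y k).
Proof. exact: polyfun_coord. Qed.

Lemma polyfun_dist2 p1 p2 : polyfun (dist2 p1 p2).
Proof.
by apply: polyfunD; apply: polyfunX; apply: polyfunB; (exact: polyfun_c2 || exact: polyfun_const).
Qed.

(** A polynomial that is not a multiple of the irreducible [f] meets the curve in finitely many
    points. *)
Lemma vanish_on_curve (h : {mpoly K[2]}) :
  ~ finite_pset (fun y => peval f y = 0 /\ peval h y = 0) ->
  forall y, peval f y = 0 -> peval h y = 0.
Proof.
move=> inf y fy; have [[k ->]|nk] := classic (exists k, h = f * k).
  by rewrite /peval mevalM -/(peval f y) fy mul0r.
case: inf; have [|s Hs] := curves_meet_finitely firr (h := h).
  by move=> k E; apply: nk; exists k.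
by exists s => z [fz hz]; apply: Hs.
Qed.

Lemma curve_not_finite (s : seq (pt K 2)) : ~ forall y, peval f y = 0 -> y \in s.
Proof. by move=> H; have [y /H ys] := curve_infinite s firr; rewrite ys. Qed.

Lemma square_root (x : K) : exists t, t ^+ 2 = x.
Proof.
have [t Et] := @solve_monicpoly K 2 (fun i => if i == 0 then x else 0) isT.
by exists t; rewrite Et big_ord_recl big_ord1 /= expr0 mulr1 mul0r addr0.
Qed.

(** [C0ne] shows that [f] does not divide [dist2 a b], so only finitely many points of the infinite
    curve are lost. *)
Lemma unisotropic_curve_not_finite : ~ finite_pset (curve0 f a b).
Proof.
move=> [s Hs]; have [h Eh] := polyfun_dist2 a b.
have [p [fp Np]] := C0ne.
have [|t Ht] := curves_meet_finitely firr (h := h).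
  move=> k Ek; move: Np; rewrite -/(dist2 a b p) -Eh Ek /peval mevalM -/(peval f p) fp mul0r.
  by rewrite eqxx.
apply: (@curve_not_finite (s ++ t)) => y fy; rewrite mem_cat.
have [N0|N0] := eqVneq (dist2 a b y) 0; last by rewrite Hs.
by rewrite Ht ?orbT // Eh.
Qed.

(* [B] in coordinates: [x = y + t (y - A)] with [t ^ 2 |y - A| ^ 2 = d ^ 2]. *)
Definition param (yt : pt K 2 * K) : pt K 5 :=
  let y1 := c2 yt.1 0 in let y2 := c2 yt.1 1 in let t := yt.2 in
  \row_i nth 0 [:: y1 + t * (y1 - a); y2 + t * (y2 - b); y1; y2; t ^+ 2 / d ^+ 2] i.

Definition base (v : pt K 5) : pt K 2 := mkpt2 (c5 v 2) (c5 v 3).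

(** Recovers t on [Bset]: from x - y = t (y - A), the inner product of x - y and y - A is t |y - A|
    ^ 2, and w inverts |y - A| ^ 2. *)
Definition ratio (v : pt K 5) : K :=
  c5 v 4 * ((c5 v 0 - c5 v 2) * (c5 v 2 - a) + (c5 v 1 - c5 v 3) * (c5 v 3 - b)).

(** The covering involution: x is reflected in y, which is t -> - t. In these coordinates it is a
    polynomial map on the whole space. *)
Definition swap (v : pt K 5) : pt K 5 :=
  \row_i nth 0 [:: 2 * c5 v 2 - c5 v 0; 2 * c5 v 3 - c5 v 1; c5 v 2; c5 v 3; c5 v 4] i.

Lemma c5_row (s : seq K) k : (k < 5)%N -> c5 (\row_(i < 5) nth 0 s i) k = nth 0 s k.
Proof. by move=> hk; rewrite /c5 mxE inordK. Qed.

Lemma row5P (v w : pt K 5) : (forall k, (k < 5)%N -> c5 v k = c5 w k) -> v = w.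
Proof. by move=> H; apply/rowP => i; have := H i (ltn_ord i); rewrite /c5 inord_val. Qed.

Lemma base_param y t : base (param (y, t)) = y.
Proof. by rewrite /base /param !c5_row //= -mk_c2. Qed.

Lemma swap_param y t : swap (param (y, t)) = param (y, - t).
Proof.
apply: row5P => k hk; rewrite /swap /param !c5_row //=.
by case: k hk => [|[|[|[|[|]]]]] //= _; rewrite ?sqrrN //; ring.
Qed.

Lemma swapK : involutive swap.
Proof.
move=> v; apply: row5P => k hk; rewrite /swap !c5_row //=.
by case: k hk => [|[|[|[|[|]]]]] //= _; ring.
Qed.

Lemma polyfun_c5 k : polyfun (fun v : pt K 5 => c5 v k).
Proof. exact: polyfun_coord. Qed.

Lemma polyfun_swap i : polyfun (fun v => swap v ord0 i).
Proof.
have [p Ep] : polyfun (fun v : pt K 5 => nth 0 [:: 2 * c5 v 2 - c5 v 0; 2 * c5 v 3 - c5 v 1;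
    c5 v 2; c5 v 3; c5 v 4] i).
  have p2 k l : polyfun (fun v : pt K 5 => 2 * c5 v k - c5 v l).
    by apply: polyfunB (polyfun_c5 l); apply: polyfunM (polyfun_c5 k); apply: polyfun_const.
  case: i => [[|[|[|[|[|]]]]] //= _]; first [exact: p2 | exact: polyfun_c5].
by exists p => v; rewrite Ep mxE.
Qed.

Lemma Bset_param v : Bset f a b d v ->
  [/\ v = param (base v, ratio v), peval f (base v) = 0 &
      ratio v ^+ 2 * dist2 a b (base v) = d ^+ 2].
Proof.
case=> H1 H2 H3 H4.
have d2 : d ^+ 2 != 0 by rewrite expf_neq0.
have t1 : ratio v * (c5 v 2 - a) = c5 v 0 - c5 v 2.
  (* The two correction terms are multiples of the collinearity equation and of w |y - A| ^ 2 =
     1. *)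
  transitivity (c5 v 0 - c5 v 2
    - c5 v 4 * (c5 v 3 - b) * ((c5 v 3 - b) * (c5 v 0 - c5 v 2) - (c5 v 2 - a) * (c5 v 1 - c5 v 3))
    + (c5 v 0 - c5 v 2) * (c5 v 4 * ((c5 v 2 - a) ^+ 2 + (c5 v 3 - b) ^+ 2) - 1)).
    by rewrite /ratio; ring.
  by rewrite H3 H4; ring.
have t2 : ratio v * (c5 v 3 - b) = c5 v 1 - c5 v 3.
  transitivity (c5 v 1 - c5 v 3
    + c5 v 4 * (c5 v 2 - a) * ((c5 v 3 - b) * (c5 v 0 - c5 v 2) - (c5 v 2 - a) * (c5 v 1 - c5 v 3))
    + (c5 v 1 - c5 v 3) * (c5 v 4 * ((c5 v 2 - a) ^+ 2 + (c5 v 3 - b) ^+ 2) - 1)).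
    by rewrite /ratio; ring.
  by rewrite H3 H4; ring.
have tN : ratio v ^+ 2 * dist2 a b (base v) = d ^+ 2.
  by rewrite /dist2 /base !c2_mk mulrDr -!exprMn t1 t2 H2.
split=> //; apply: row5P => k hk; rewrite /param !c5_row //= !c2_mk t1 t2.
case: k hk => [|[|[|[|[|]]]]] //= _; try ring.
apply: (mulIf d2); rewrite divfK // -tN /dist2 /base !c2_mk.
by rewrite mulrCA H4 mulr1.
Qed.

Lemma param_Bset y t : peval f y = 0 -> t ^+ 2 * dist2 a b y = d ^+ 2 ->
  Bset f a b d (param (y, t)).
Proof.
move=> fy E; rewrite /Bset -/(base _) base_param /param !c5_row //=.
have d2 : d ^+ 2 != 0 by rewrite expf_neq0.
split=> //; first by rewrite -E /dist2; ring.
- by ring.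
- by rewrite mulrAC -/(dist2 a b y) E divff.
Qed.

Lemma swap_Bset v : Bset f a b d v -> Bset f a b d (swap v).
Proof.
move=> /Bset_param [Ev fy E]; rewrite Ev swap_param.
by apply: param_Bset; rewrite ?sqrrN.
Qed.

Lemma Bset_closed : zclosed (Bset f a b d).
Proof.
(* Beyond the four equations the default value 0 of [nth] gives the trivial condition 0 = 0, so all
   natural numbers may serve as indices. *)
pose S (i : nat) : pset K 5 := fun v =>
  nth 0 [:: peval f (base v); (c5 v 0 - c5 v 2) ^+ 2 + (c5 v 1 - c5 v 3) ^+ 2 - d ^+ 2;
   (c5 v 3 - b) * (c5 v 0 - c5 v 2) - (c5 v 2 - a) * (c5 v 1 - c5 v 3);
   c5 v 4 * ((c5 v 2 - a) ^+ 2 + (c5 v 3 - b) ^+ 2) - 1] i = 0.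
have cS i : zclosed (S i).
  have pc := polyfun_c5.
  apply: zclosed_eq0; case: i => [|[|[|[|i]]]] /=.
  - apply: polyfun_comp => i.
    have [p Ep] : polyfun (fun v : pt K 5 => if i == 0 :> nat then c5 v 2 else c5 v 3).
      by case: (i == 0 :> nat).
    by exists p => v; rewrite Ep mxE.
  - apply: polyfunB; last exact: polyfun_const.
    by apply: polyfunD; apply: polyfunX; apply: polyfunB.
  - by apply: polyfunB; apply: polyfunM; apply: polyfunB => //; apply: polyfun_const.
  - apply: polyfunB; last exact: polyfun_const.
    apply: polyfunM => //; apply: polyfunD; apply: polyfunX; apply: polyfunB => //.
      exact: polyfun_const.
    exact: polyfun_const.
  - by rewrite nth_nil; apply: polyfun_const.
apply: eq_zclosed (zclosedI cS) => v; split=> [H|[H1 H2 H3 H4] [|[|[|[|i]]]]]; rewrite /S /=.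
- split; [exact: (H 0) | | exact: (H 2) | ].
    by apply/eqP; rewrite -subr_eq0; apply/eqP; exact: (H 1).
  by apply/eqP; rewrite -subr_eq0; apply/eqP; exact: (H 3).
- exact: H1.
- by rewrite H2 subrr.
- by rewrite H3.
- by rewrite H4 subrr.
- by rewrite nth_nil.
Qed.

(** The base point determines t ^ 2 = d ^ 2 / |y - A| ^ 2, hence t up to sign; the denominator is
    nonzero because d is. *)
Lemma Bset_fiber v w : Bset f a b d v -> Bset f a b d w -> base w = base v ->
  w = v \/ w = swap v.
Proof.
move=> /Bset_param [Ev _ tv] /Bset_param [Ew _ tw] E.
have N0 : dist2 a b (base v) != 0.
  by apply/eqP => N0; move/eqP: tv; rewrite N0 mulr0 eq_sym sqrf_eq0 (negPf dn0).
have : ratio w ^+ 2 == ratio v ^+ 2.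
  by apply/eqP; apply: (mulIf N0); rewrite tv -tw E.
rewrite eqf_sqr => /orP [] /eqP Er; [left|right].
  by rewrite Ew E Er -Ev.
by rewrite Ew E Er -swap_param -Ev.
Qed.

Lemma Bset_finite_base (A : pset K 5) : psubset A (Bset f a b d) ->
  finite_pset (fun y => exists2 v, A v & base v = y) -> finite_pset A.
Proof.
move=> AB [s Hs]; apply: (finite_fibers (v := base) (s := s)) => [y|v Av]; last first.
  by apply: Hs; exists v.
have [[v [Av Ev]]|nv] := classic (exists v, A v /\ base v = y); last first.
  by exists [::] => v H; case: nv; exists v.
exists [:: v; swap v] => w [Aw Ew]; rewrite !inE.
have [|->|->] := Bset_fiber (AB _ Av) (AB _ Aw); rewrite ?eqxx ?orbT //.
by rewrite Ev.
Qed.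

(** Over each of the infinitely many points of [curve0] a square root of d ^ 2 / |y - A| ^ 2 gives a
    point of [Bset]. *)
Lemma Bset_not_finite : ~ finite_pset (Bset f a b d).
Proof.
move=> [s Hs]; apply: unisotropic_curve_not_finite.
exists [seq base v | v <- s] => y [fy Ny].
have [t Et] := square_root (d ^+ 2 / dist2 a b y).
apply/mapP; exists (param (y, t)); last by rewrite base_param.
by apply: Hs; apply: param_Bset => //; rewrite Et divfK.
Qed.

Lemma quadratic_param i : quadratic (dist2 a b) (d ^+ 2) (fun yt => param yt ord0 i).
Proof.
pose N := dist2 a b; have pN := polyfun_dist2 a b.
have qc c : quadratic N (d ^+ 2) (fun=> c) by exact: quadratic_const.
have qD := quadraticD pN (e := d ^+ 2); have qM := quadraticM pN (e := d ^+ 2).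
have qr : quadratic N (d ^+ 2) snd by exact: quadratic_root.
have qp k : quadratic N (d ^+ 2) (fun t => c2 t.1 k).
  by exact: (@quadratic_poly _ _ _ (fun z => c2 z k) (polyfun_c2 k)).
(* Differences, the square and the quotient are spelled as sums and products to fit the closure
   properties. *)
apply: (@eq_quadratic _ _ _ (fun yt => nth 0 [:: c2 yt.1 0 + yt.2 * (c2 yt.1 0 + - a);
   c2 yt.1 1 + yt.2 * (c2 yt.1 1 + - b); c2 yt.1 0; c2 yt.1 1; yt.2 * yt.2 * (d ^+ 2)^-1] i)).
  by move=> t; rewrite mxE.
case: i => [[|[|[|[|[|]]]]] //= _]; try exact: qp.
- by apply: (qD) => //; apply: (qM) => //; apply: (qD).
- by apply: (qD) => //; apply: (qM) => //; apply: (qD).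
- by apply: (qM) => //; apply: (qM).
Qed.

(** If g vanishes on [Z], its norm vanishes at the infinitely many base points of [Z], thus on the
    whole curve; so g vanishes at [v] or at [swap v]. *)
Lemma Bset_dominant Z : zclosed Z -> psubset Z (Bset f a b d) -> ~ finite_pset Z ->
  forall v, Bset f a b d v -> Z v \/ Z (swap v).
Proof.
move=> cZ ZB infZ v Bv; apply: NNPP => /not_or_and [nZv nZsv].
have key g : (forall z, Z z -> peval g z = 0) -> peval g v = 0 \/ peval g (swap v) = 0.
  move=> Zg; have [h [k Hh]] := quadratic_norm (polyfun_dist2 a b) g quadratic_param.
  have [Ev fv Nv] := Bset_param Bv.
  have hv : peval h (base v) = 0.
    apply: vanish_on_curve fv => fin; apply: infZ; apply: Bset_finite_base => //.
    apply: finite_psetS fin => _ [z Zz <-].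
    have [Ez fz Nz] := Bset_param (ZB z Zz); split=> //.
    by rewrite (Hh _ _ Nz) -Ez Zg // mul0r mulr0.
  move/eqP: hv; rewrite (Hh _ _ Nv) -swap_param -Ev !mulf_eq0 expf_eq0.
  have -> : dist2 a b (base v) == 0 = false.
    by apply/eqP => N0; move/eqP: Nv; rewrite N0 mulr0 eq_sym sqrf_eq0 (negPf dn0).
  by rewrite andbF /= => /orP [] /eqP; auto.
(* If [Z] missed both points, g nonzero at [v] would vanish at [swap v], and h nonzero at [swap v]
   would vanish at [v]; then g + h would vanish at neither, although it vanishes on [Z]. *)
have [g Zg gv] := zclosed_separate cZ nZv.
have [h Zh hv] := zclosed_separate cZ nZsv.
have gsv : peval g (swap v) = 0 by case: (key g Zg) gv => // ->; rewrite eqxx.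
have hsv : peval h v = 0 by case: (key h Zh) hv => // ->; rewrite eqxx.
case: (key (g + h)) => [z Zz||]; rewrite /peval mevalD -!/(peval _ _).
- by rewrite Zg // Zh // addr0.
- by rewrite hsv addr0 => E; rewrite E eqxx in gv.
- by rewrite gsv add0r => E; rewrite E eqxx in hv.
Qed.


Lemma Bset_component : exists G, [/\ zclosed G, zirreducible G, ~ finite_pset G,
  psubset G (Bset f a b d) & forall v, Bset f a b d v -> G v \/ G (swap v)].
Proof.
exact: (double_cover_component Bset_closed Bset_not_finite swapK polyfun_swap Bset_dominant).
Qed.

Lemma Bset_dim1 G : zclosed G -> zirreducible G -> ~ finite_pset G ->
  psubset G (Bset f a b d) -> zdim_eq G 1.
Proof. exact: (double_cover_dim1 swapK polyfun_swap Bset_dominant). Qed.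

(** * Projection to the plane and contracted subsets *)

Lemma proj1_param y t : proj1_pt (param (y, t)) =
  mkpt2 (c2 y 0 + t * (c2 y 0 - a)) (c2 y 1 + t * (c2 y 1 - b)).
Proof. by rewrite /proj1_pt /param !c5_row. Qed.

Lemma polyfun_mkpt2 n (u w : pt K n -> K) i : polyfun u -> polyfun w ->
  polyfun (fun x => mkpt2 (u x) (w x) ord0 i).
Proof.
move=> pu pw; have [p Ep] : polyfun (fun x => if i == 0 :> nat then u x else w x).
  by case: (i == 0 :> nat).
by exists p => x; rewrite Ep mxE.
Qed.

Lemma pt2P (y z : pt K 2) : c2 y 0 = c2 z 0 -> c2 y 1 = c2 z 1 -> y = z.
Proof. by rewrite [y]mk_c2 [z]mk_c2 !c2_mk => -> ->. Qed.

(* [z + d ^ 2 / z] and [z - d ^ 2 / z] parametrise the circle by the punctured line. *)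
Definition circle_point (i z : K) : pt K 2 :=
  mkpt2 (a + (z + d ^+ 2 / z) / 2) (b + (z - d ^+ 2 / z) / (2 * i)).

Lemma circle_pointP (i : K) y : i ^+ 2 = -1 -> circle a b d y ->
  exists2 z, z != 0 & y = circle_point i z.
Proof.
move=> i2 cy; have t0 := two_neq0.
have i0 : i != 0 by rewrite -sqrf_eq0 i2 oppr_eq0 oner_neq0.
(* With i ^ 2 = -1 the equation of the circle factors as z z' = d ^ 2. *)
pose z := (c2 y 0 - a) + i * (c2 y 1 - b); pose z' := (c2 y 0 - a) - i * (c2 y 1 - b).
have zz' : z * z' = d ^+ 2.
  transitivity ((c2 y 0 - a) ^+ 2 - i ^+ 2 * (c2 y 1 - b) ^+ 2); first by rewrite /z /z'; ring.
  by rewrite i2 mulN1r opprK.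
have z0 : z != 0.
  by apply/eqP => E; move/eqP: zz'; rewrite E mul0r eq_sym sqrf_eq0 (negPf dn0).
have Ez' : d ^+ 2 / z = z' by rewrite -zz' mulrC mulKf.
exists z => //; apply: pt2P; rewrite /circle_point !c2_mk Ez' /z /z'.
  by field.
by field; rewrite t0 i0.
Qed.

(** Along the parametrisation [f] is a Laurent polynomial. It vanishes at the parameters of the
    infinitely many points of the curve, hence identically. *)
Lemma circle_sub_curve : (forall y, peval f y = 0 -> circle a b d y) ->
  forall y, circle a b d y -> peval f y = 0.
Proof.
move=> fc y cy; have [i i2] := square_root (-1).
pose Laurent (u : K -> K) := exists (p : {poly K}) k, forall z, z != 0 -> z ^+ k * u z = p.[z].
have LC c : Laurent (fun=> c).
  by exists c%:P, 0 => z _; rewrite expr0 mul1r hornerC.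
have LD u w : Laurent u -> Laurent w -> Laurent (fun z => u z + w z).
  move=> [p [k E]] [q [l E']]; exists ('X^l * p + 'X^k * q), (k + l) => z z0.
  by rewrite hornerD !hornerM !hornerXn -E // -E' // exprD; ring.
have LM u w : Laurent u -> Laurent w -> Laurent (fun z => u z * w z).
  move=> [p [k E]] [q [l E']]; exists (p * q), (k + l) => z z0.
  by rewrite hornerM -E // -E' // exprD; ring.
have LE u w : (forall z, u z = w z) -> Laurent u -> Laurent w.
  by move=> Eu [p [k E]]; exists p, k => z; rewrite -Eu; apply: E.
have LX : Laurent id by exists 'X, 0 => z _; rewrite expr0 mul1r hornerX.
have LV : Laurent (fun z => z^-1) by exists 1, 1 => z z0; rewrite expr1 divff // hornerC.
have [p [k Ep]] : Laurent (fun z => peval f (circle_point i z)).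
  apply: peval_ind => // j; rewrite /circle_point.
  have Lj : Laurent (fun z => if j == 0 :> nat then a + (z + d ^+ 2 * z^-1) * 2^-1
                        else b + (z + (- d ^+ 2) * z^-1) * (2 * i)^-1).
    by case: (j == 0 :> nat); apply: (LD) => //; apply: (LM) => //; apply: (LD) => //; apply: (LM).
  by apply: LE Lj => z; rewrite mxE mulNr.
have p0 : p = 0.
  apply/eqP/negPn/negP => /roots_list [s Hs].
  apply: (@curve_not_finite [seq circle_point i z | z <- s]) => x fx.
  have [z z0 Ex] := circle_pointP i2 (fc x fx).
  by rewrite Ex map_f // Hs // -Ep // -Ex fx mulr0.
have [z z0 Ey] := circle_pointP i2 cy.
by move: (Ep z z0) => /eqP; rewrite Ey p0 horner0 mulf_eq0 expf_eq0 (negPf z0) andbF => /eqP.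
Qed.

(** Every point of the curve is at squared distance d ^ 2 from p and on a line with p and A. If p
    differs from A, this leaves at most two points; so p = A and the curve is the circle. *)
Lemma circle_of_contracted A (p : pt K 2) : psubset A (Bset f a b d) -> ~ finite_pset A ->
  (forall v, A v -> proj1_pt v = p) -> pseteq (curve f) (circle a b d).
Proof.
move=> AB infA Ap; rewrite [p]mk_c2 in Ap; move: (c2 p 0) (c2 p 1) Ap => p1 p2 Ap.
(* A polynomial condition on the base points of [A] holds at infinitely many points of the curve,
   thus on all of it. *)
have onC (u : pt K 2 -> K) : polyfun u -> (forall v, A v -> u (base v) = 0) ->
    forall y, peval f y = 0 -> u y = 0.
  move=> [h Eh] Au y fy; rewrite -Eh; apply: vanish_on_curve fy => fin; apply: infA.
  apply: Bset_finite_base => //; apply: finite_psetS fin => _ [v Av <-].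
  by have [fv _ _ _] := AB v Av; rewrite Eh Au.
have Ax v : A v -> c5 v 0 = p1 /\ c5 v 1 = p2.
  move=> /Ap E; split.
    by have := congr1 (fun q : pt K 2 => c2 q 0) E; rewrite /proj1_pt !c2_mk.
  by have := congr1 (fun q : pt K 2 => c2 q 1) E; rewrite /proj1_pt !c2_mk.
have pc := polyfun_c2; have pk (c : K) : polyfun (fun _ : pt K 2 => c) by exact: polyfun_const.
have Cd y : peval f y = 0 -> dist2 p1 p2 y = d ^+ 2.
  move=> fy; apply/eqP; rewrite -subr_eq0; apply/eqP; move: y fy.
  apply: onC => [|v Av]; first by apply: polyfunB => //; apply: polyfun_dist2.
  have [_ H _ _] := AB v Av; have [E1 E2] := Ax v Av.
  by rewrite -H E1 E2 /dist2 /base !c2_mk; ring.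
have Cl y : peval f y = 0 -> (p1 - a) * (c2 y 1 - p2) - (p2 - b) * (c2 y 0 - p1) = 0.
  move: y; apply: onC => [|v Av].
    by apply: polyfunB; apply: polyfunM => //; apply: polyfunB.
  have [_ _ H _] := AB v Av; have [E1 E2] := Ax v Av.
  by rewrite -H E1 E2 /base !c2_mk; ring.
suff [E1 E2] : p1 = a /\ p2 = b.
  have fc y : peval f y = 0 -> circle a b d y by move=> /Cd; rewrite E1 E2.
  by move=> y; split; [exact: fc | apply: circle_sub_curve].
apply: NNPP => np.
have col y : peval f y = 0 -> exists s, y = mkpt2 (p1 + s * (p1 - a)) (p2 + s * (p2 - b)).
  move=> /Cl E.
  have [u1|u1] := eqVneq (p1 - a) 0; last first.
    exists ((c2 y 0 - p1) / (p1 - a)); apply: pt2P; rewrite !c2_mk; first by field.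
    apply: (mulfI u1); apply/eqP; rewrite -subr_eq0 -{}E; apply/eqP; by field.
  have [u2|u2] := eqVneq (p2 - b) 0.
    by case: np; split; apply/eqP; rewrite -subr_eq0 ?u1 ?u2.
  exists ((c2 y 1 - p2) / (p2 - b)); apply: pt2P; rewrite !c2_mk; last by field.
  apply: (mulfI u2); move/eqP: E; rewrite u1 mul0r sub0r oppr_eq0 => /eqP E.
  by rewrite mulr0 addr0; apply/eqP; rewrite -subr_eq0 -mulrBr E.
have [y0 fy0 _] := curve_infinite [::] firr.
have [s0 Ey0] := col y0 fy0.
pose q s := mkpt2 (p1 + s * (p1 - a)) (p2 + s * (p2 - b)).
(* On the line p + s (p - A) the distance condition reads s ^ 2 |p - A| ^ 2 = d ^ 2 and fixes s up
   to sign. *)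
apply: (@curve_not_finite [:: q s0; q (- s0)]) => y fy; have [s Ey] := col y fy.
have sN (z : pt K 2) r : peval f z = 0 -> z = q r ->
    r ^+ 2 * ((p1 - a) ^+ 2 + (p2 - b) ^+ 2) = d ^+ 2.
  by move=> /Cd <- ->; rewrite /dist2 /q !c2_mk; ring.
have N0 : (p1 - a) ^+ 2 + (p2 - b) ^+ 2 != 0.
  apply/eqP => N0; move/eqP: (sN _ _ fy0 Ey0).
  by rewrite N0 mulr0 eq_sym sqrf_eq0 (negPf dn0).
have : s ^+ 2 == s0 ^+ 2.
  by apply/eqP/(mulIf N0); rewrite (sN _ _ fy Ey) (sN _ _ fy0 Ey0).
by rewrite eqf_sqr Ey !inE => /orP [] /eqP ->; rewrite eqxx ?orbT.
Qed.


(** * A nonzero polynomial vanishing on the conchoid *)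

Lemma radial_polynomial (p : pt K 2) : exists F : {poly K}, forall rho,
  peval f (mkpt2 (a + rho * (c2 p 0 - a)) (b + rho * (c2 p 1 - b))) = F.[rho].
Proof.
apply: (peval_ind (Q := fun u => exists F : {poly K}, forall rho, u rho = F.[rho])).
- by move=> c; exists c%:P => rho; rewrite hornerC.
- by move=> u w [F E] [G E']; exists (F + G) => rho; rewrite hornerD E E'.
- by move=> u w [F E] [G E']; exists (F * G) => rho; rewrite hornerM E E'.
- by move=> u w Eu [F E]; exists F => rho; rewrite -Eu.
- move=> j; pose c := if j == 0 :> nat then a else b.
  exists (c%:P + 'X * ((if j == 0 :> nat then c2 p 0 - a else c2 p 1 - b)%:P)) => rho.
  by rewrite hornerD hornerM !hornerC hornerX mxE /c; case: ifP.
Qed.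

(* For [x] in the conchoid, [y] is one of the two points [A + (1 + r) (x - A)] with
   [r ^ 2 |x - A| ^ 2 = d ^ 2]; the product of the values of [f] at both is
   a polynomial in [x]. *)
Lemma conchoid_eliminant : exists2 q : {mpoly K[2]}, q != 0 &
  forall v, Bset f a b d v -> peval q (proj1_pt v) = 0.
Proof.
pose M := dist2 a b; have pM := polyfun_dist2 a b.
pose w (zr : pt K 2 * K) :=
  mkpt2 (a + (1 + zr.2) * (c2 zr.1 0 - a)) (b + (1 + zr.2) * (c2 zr.1 1 - b)).
have wq i : quadratic M (d ^+ 2) (fun zr => w zr ord0 i).
  have qc c : quadratic M (d ^+ 2) (fun=> c) by exact: quadratic_const.
  have qD := quadraticD pM (e := d ^+ 2); have qM := quadraticM pM (e := d ^+ 2).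
  have qr : quadratic M (d ^+ 2) snd by exact: quadratic_root.
  have qp k c : quadratic M (d ^+ 2) (fun zr => c2 zr.1 k - c).
    apply: (@quadratic_poly _ _ _ (fun z => c2 z k - c)).
    by apply: polyfunB; [exact: polyfun_c2 | exact: polyfun_const].
  have qj : quadratic M (d ^+ 2) (fun zr => if i == 0 :> nat then
      a + (1 + zr.2) * (c2 zr.1 0 - a) else b + (1 + zr.2) * (c2 zr.1 1 - b)).
    by case: (i == 0 :> nat); apply: (qD) => //; apply: (qM) => //; apply: (qD).
  by apply: eq_quadratic qj => zr; rewrite mxE.
have [h [k Hh]] := quadratic_norm pM f wq.
have [Mp EM] := pM.
(* The factor [Mp] takes care of t = -1, where x = A and y cannot be recovered from x. *)
exists (h * Mp); last first.
  move=> v /Bset_param [Ev fy tN]; rewrite Ev; move: (base v) (ratio v) fy tN => y t fy tN.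
  rewrite proj1_param; set x := mkpt2 _ _.
  have Mx : M x = (1 + t) ^+ 2 * M y by rewrite /M /dist2 /x !c2_mk; ring.
  rewrite /peval mevalM -!/(peval _ _) EM -/(M x).
  have [t1|t1] := eqVneq (1 + t) 0; first by rewrite Mx t1 expr0n mul0r mulr0.
  (* From x - A = (1 + t) (y - A) one gets y = A + (1 + r) (x - A) with 1 + r = 1 / (1 + t). *)
  have rM : (- (t / (1 + t))) ^+ 2 * M x = d ^+ 2 by rewrite Mx -tN /M; field.
  rewrite (Hh _ _ rM).
  have -> : w (x, - (t / (1 + t))) = y.
    by apply: pt2P; rewrite /w /x /= !c2_mk; field.
  by rewrite fy mul0r mulr0 mul0r.
have f0 : f != 0 by case: firr.
have Mp0 : Mp != 0.
  have [p [_ Np]] := C0ne; apply: contra Np => /eqP E.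
  by rewrite -/(dist2 a b p) -EM E /peval meval0.
(* To see that the product is nonzero, take p with f(p) and |p - A| ^ 2 nonzero and put x = A + rho
   (p - A). The two candidates for y are A + (rho + tau) (p - A) and A + (rho - tau) (p - A), where
   [f] takes the values F(rho + tau) and F(rho - tau). As F(1) = f(p) is nonzero, some nonzero rho
   avoids all roots. *)
apply/eqP => q0; have [p] := mpoly_nonvanishing (mulf_neq0 f0 Mp0).
rewrite /peval mevalM -!/(peval _ _) EM mulf_eq0 negb_or => /andP [fp Np].
have [tau Etau] := square_root (d ^+ 2 / dist2 a b p).
have [F EF] := radial_polynomial p.
have shift0 c : F \Po ('X + c%:P) != 0.
  apply/eqP => /(congr1 (fun P : {poly K} => P.[1 - c])) /eqP.
  rewrite horner0 horner_comp hornerD hornerX hornerC subrK -EF !mul1r.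
  by rewrite [a + _]addrC [b + _]addrC !subrK -mk_c2; apply/negP.
have /closed_nonrootP [rho] : 'X * ((F \Po ('X + tau%:P)) * (F \Po ('X + (- tau)%:P))) != 0.
  by rewrite !mulf_neq0 ?polyX_eq0.
rewrite /root !hornerM !horner_comp !hornerD !hornerX !hornerC !mulf_eq0 !negb_or -!EF.
move=> /and3P [rho0 F1 F2].
pose x := mkpt2 (a + rho * (c2 p 0 - a)) (b + rho * (c2 p 1 - b)).
have Mx : M x = rho ^+ 2 * dist2 a b p by rewrite /M /dist2 /x !c2_mk; ring.
have Mx0 : M x != 0 by rewrite Mx mulf_neq0 ?expf_neq0.
have rM : (tau / rho) ^+ 2 * M x = d ^+ 2.
  by rewrite Mx expr_div_n mulrA divfK ?expf_neq0 // Etau divfK.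
have /eqP : peval (h * Mp) x = 0 by rewrite q0 /peval meval0.
rewrite /peval mevalM -!/(peval _ _) EM (Hh _ _ rM) -/(M x).
have wE r : w (x, r / rho) = mkpt2 (a + (rho + r) * (c2 p 0 - a)) (b + (rho + r) * (c2 p 1 - b)).
  by apply: pt2P; rewrite /w /x /= !c2_mk; field.
rewrite -mulNr !wE !mulf_eq0 expf_eq0 (negPf Mx0) andbF (negPf F1) (negPf F2).
by [].
Qed.

(** If [q] factors, the irreducible [Z] lies in the zero set of one factor; induction on the degree
    ends at an irreducible factor. *)
Lemma irreducible_vanishing (Z : pset K 2) (q : {mpoly K[2]}) : zirreducible Z ->
  q != 0 -> (forall x, Z x -> peval q x = 0) ->
  exists2 g, irreducible_mpoly g & forall x, Z x -> peval g x = 0.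
Proof.
move=> [[x0 Zx0] irr].
(* As [msize] is the degree plus one, a product has size the sum minus one; nonunit factors of size
   at least 2 are thus both smaller than [q]. *)
have unit_msize (g : {mpoly K[2]}) : g != 0 -> g \isn't a GRing.unit -> (1 < msize g)%N.
  move=> g0; apply: contraR; rewrite -leqNgt => s1.
  have /msize_poly1P [c c0 ->] : msize g == 1%N.
    by rewrite eqn_leq s1 lt0n msize_poly_eq0.
  by rewrite -[c%:MP]/(mpolyC 2 c) rmorph_unit // unitfE.
move: {2}(msize q) (leqnn (msize q)) => n; elim: n q => [|n IHn] q sq q0 Zq.
  by move: sq; rewrite leqn0 msize_poly_eq0 (negPf q0).
have [iq|niq] := classic (irreducible_mpoly q); first by exists q.
have qnu : q \isn't a GRing.unit.
  apply/negP => uq; have : peval q x0 \is a GRing.unit by apply: rmorph_unit.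
  by rewrite Zq // unitr0.
have [g [h [E gnu hnu]]] : exists g h : {mpoly K[2]},
    [/\ q = g * h, g \isn't a GRing.unit & h \isn't a GRing.unit].
  apply: NNPP => ngh; apply: niq; split=> // g h E.
  have [|gnu] := boolP (g \is a GRing.unit); first by left.
  have [|hnu] := boolP (h \is a GRing.unit); first by right.
  by case: ngh; exists g, h.
have [g0 h0] : g != 0 /\ h != 0.
  by split; apply: contraNneq q0 => E0; rewrite E E0 (mul0r, mulr0).
have sg := unit_msize g g0 gnu; have sh := unit_msize h h0 hnu.
move: sq; rewrite E msizeM // => sq.
have cz (p : {mpoly K[2]}) : zclosed (fun x => peval p x = 0).
  by apply: zclosed_eq0; exists p.
have [x Zx|Zg|Zh] := irr _ _ (cz g) (cz h).
- move/eqP: (Zq x Zx); rewrite E /peval mevalM mulf_eq0 => /orP [] /eqP; auto.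
- apply: (IHn g) => //; move: (msize g) (msize h) sq sg sh => u w; lia.
- apply: (IHn h) => //; move: (msize g) (msize h) sq sg sh => u w; lia.
Qed.

(** * Dimension of the images and the exceptional circle *)

Definition image_closure (G : pset K 5) : pset K 2 :=
  zclosure (fun x => exists v, G v /\ x = proj1_pt v).

Lemma polyfun_proj1 i : polyfun (fun v : pt K 5 => proj1_pt v ord0 i).
Proof. by apply: polyfun_mkpt2; apply: polyfun_c5. Qed.

(** A finite image would be a point, which forces the circle. For the upper bound, [Z'] lies on an
    irreducible curve g = 0; if [Z] misses a point of [Z'], a polynomial separating that point is no
    multiple of g, so [Z] is finite. *)
Lemma image_closure_dim1 G : ~ pseteq (curve f) (circle a b d) ->
  zirreducible G -> ~ finite_pset G -> psubset G (Bset f a b d) ->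
  zdim_eq (image_closure G) 1.
Proof.
move=> ncirc iG infG GB; have iP := zirreducible_image polyfun_proj1 iG.
apply: zdim1P => //; first exact: zclosure_closed.
  move=> /(zirreducible_finite iP) [p Ep]; apply: ncirc.
  apply: (circle_of_contracted GB infG) => v Gv.
  by apply/Ep; apply: sub_zclosure; exists v.
move=> Z Z' cZ cZ' _ iZ' infZ ZZ' Z'P x Z'x; apply: NNPP => nZx; apply: infZ.
have [h Zh hx] := zclosed_separate cZ nZx.
have [q q0 Bq] := conchoid_eliminant.
have Z'q y : Z' y -> peval q y = 0.
  move/Z'P; move: y; apply: zclosure_min; first by apply: zclosed_eq0; exists q.
  by move=> _ [v [/GB Bv ->]]; apply: Bq.
have [g ig Z'g] := irreducible_vanishing iZ' q0 Z'q.
have [|s Hs] := curves_meet_finitely ig (h := h).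
  move=> k E; move/eqP: hx; apply.
  by rewrite E /peval mevalM -/(peval g x) Z'g // mul0r.
by exists s => y Zy; apply: Hs; [apply/Z'g/ZZ' | apply: Zh].
Qed.

(** On the circle t ^ 2 = 1: t = -1 gives x = A, and t = 1 gives x = A + 2 (y - A). *)
Lemma conchoid_of_circle : pseteq (curve f) (circle a b d) ->
  pseteq (conchoid f a b d) (fun x => x = mkpt2 a b \/ circle a b (2 * d) x).
Proof.
move=> Ef; have t0 := two_neq0.
have fc y : peval f y = 0 -> dist2 a b y = d ^+ 2 by move/Ef.
move=> x; split.
  move: x; apply: zclosure_min.
    apply: zclosedU (zclosed1 _) _; apply: zclosed_eq; last exact: polyfun_const.
    exact: polyfun_dist2.
  move=> _ [v [/Bset_param [Ev fy tN] ->]]; rewrite Ev.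
  move: (base v) (ratio v) fy tN => y t fy; rewrite (fc y fy) proj1_param => tN.
  have : t ^+ 2 == 1 by rewrite -(inj_eq (mulIf (expf_neq0 2 dn0))) tN mul1r.
  rewrite sqrf_eq1 => /orP [] /eqP ->.
    right; rewrite /circle !c2_mk exprMn -(fc y fy) /dist2; ring.
  by left; apply: pt2P; rewrite !c2_mk; ring.
case=> [->|cx]; apply: sub_zclosure.
  have [y [fy _]] := C0ne; exists (param (y, -1)); split.
    by apply: param_Bset => //; rewrite (fc y fy) sqrrN expr1n mul1r.
  by rewrite proj1_param; apply: pt2P; rewrite !c2_mk; ring.
(* The midpoint of A and x. *)
pose y := mkpt2 (a + (c2 x 0 - a) / 2) (b + (c2 x 1 - b) / 2).
have cy : circle a b d y.
  rewrite /circle /y !c2_mk; apply: (mulfI (expf_neq0 2 t0)).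
  by rewrite -exprMn -cx; field.
have fy : peval f y = 0 by apply/Ef.
exists (param (y, 1)); split.
  by apply: param_Bset => //; rewrite (fc y fy) expr1n mul1r.
by rewrite proj1_param; apply: pt2P; rewrite /y !c2_mk; field.
Qed.

End Conchoid.

(** * From one component and its conjugate to the four claims *)

Theorem theorem1 (K : closedFieldType) (charK0 : [pchar K] =i pred0)
  (f : {mpoly K[2]}) (firr : irreducible_mpoly f) (a b d : K) (dn0 : d != 0)
  (C0ne : exists p, curve0 f a b p) :
  [/\ (forall Y, irr_component (Bset f a b d) Y -> zdim_eq Y 1),
      (~ pseteq (curve f) (circle a b d) ->
         forall Y, irr_component (conchoid f a b d) Y -> zdim_eq Y 1),
      (pseteq (curve f) (circle a b d) ->
         pseteq (conchoid f a b d)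
                (fun x => x = mkpt2 a b \/ circle a b (2 * d) x)) &
      (forall Y1 Y2 Y3, irr_component (conchoid f a b d) Y1 ->
         irr_component (conchoid f a b d) Y2 -> irr_component (conchoid f a b d) Y3 ->
         [\/ pseteq Y1 Y2, pseteq Y1 Y3 | pseteq Y2 Y3])].
Proof.
have [G [cG iG infG GB cov]] := Bset_component firr dn0 C0ne.
(* The conjugate of [G] has the same properties, and [Bset] is the union of [G] and [G']. *)
pose G' v := G (swap v).
have pS := @polyfun_swap K; have sK := @swapK K.
have cG' : zclosed G' by apply: zclosed_preimage.
have iG' : zirreducible G'.
  split; first by have [[v Gv] _] := iG; exists (swap v); rewrite /G' sK.
  move=> Z1 Z2 c1 c2 sub.
  have [v Gv|H|H] := iG.2 _ _ (zclosed_preimage pS c1) (zclosed_preimage pS c2).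
  - by apply: sub; rewrite /G' sK.
  - by left => v G'v; rewrite -[v]sK; apply: H.
  - by right => v G'v; rewrite -[v]sK; apply: H.
have infG' : ~ finite_pset G'.
  move=> [s Hs]; apply: infG; exists [seq swap v | v <- s] => v Gv.
  by rewrite -[v]sK map_f // Hs // /G' sK.
have G'B : psubset G' (Bset f a b d).
  by move=> v /GB/(swap_Bset dn0); rewrite sK.
pose P := image_closure G; pose P' := image_closure G'.
(* The closed images of [G] and [G'] are irreducible and cover the conchoid, so every component is
   one of them. *)
have comp Y : irr_component (conchoid f a b d) Y -> pseteq Y P \/ pseteq Y P'.
  have sub H : psubset H (Bset f a b d) -> psubset (image_closure H) (conchoid f a b d).
    move=> HB; apply: zclosure_min; first exact: zclosure_closed.
    by move=> _ [v [/HB Bv ->]]; apply: sub_zclosure; exists v.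
  apply: irr_component_of_cover; try exact: zclosure_closed; try exact: sub.
  - exact: zirreducible_image (@polyfun_proj1 K) iG.
  - exact: zirreducible_image (@polyfun_proj1 K) iG'.
  - apply: zclosure_min; first by apply: zclosedU; apply: zclosure_closed.
    move=> _ [v [/cov [Gv|Gv] ->]]; [left|right]; apply: sub_zclosure; by exists v.
split.
- have dG : zdim_eq G 1 by exact: (Bset_dim1 firr dn0 cG iG infG GB).
  have dG' : zdim_eq G' 1 by exact: (Bset_dim1 firr dn0 cG' iG' infG' G'B).
  by move=> Y /(irr_component_of_cover iG iG' cG cG' GB G'B cov) [] E;
    [apply: eq_zdim dG | apply: eq_zdim dG'] => v; split=> /E.
- move=> nc.
  have dP : zdim_eq P 1 by exact: (image_closure_dim1 charK0 firr dn0 C0ne nc iG infG GB).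
  have dP' : zdim_eq P' 1 by exact: (image_closure_dim1 charK0 firr dn0 C0ne nc iG' infG' G'B).
  by move=> Y /comp [] E; [apply: eq_zdim dP | apply: eq_zdim dP'] => x; split=> /E.
- exact: (conchoid_of_circle charK0 dn0 C0ne).
(* Three components are distributed over two sets, so two of them agree. *)
have tr (A B C : pset K 2) : pseteq A C -> pseteq B C -> pseteq A B.
  by move=> EA EB x; rewrite EA EB.
move=> Y1 Y2 Y3 /comp [] E1 /comp [] E2 /comp [] E3;
  (by apply: Or31; apply: tr E1 E2) || (by apply: Or32; apply: tr E1 E3) ||
  (by apply: Or33; apply: tr E2 E3).
Qed.
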